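(* Every 3-tri-Leibniz algebra is induced by an embedding tensor on a 3-Leibniz algebra with respect to a representation. That is, for every 3-tri-Leibniz algebra $(\mathfrak{h},[\cdot,\cdot,\cdot]_\vdash,[\cdot,\cdot,\cdot]_\dashv,[\cdot,\cdot,\cdot]_\perp)$ there exist a 3-Leibniz algebra $(\mathfrak{g},[\cdot,\cdot,\cdot]_{\mathfrak{g}})$, a representation $(\mathfrak{h};\rho^l,\rho^m,\rho^r)$ of $\mathfrak{g}$ on the vector space $\mathfrak{h}$, and an embedding tensor $T:\mathfrak{h}\to\mathfrak{g}$ on $\mathfrak{g}$ with respect to this representation such that for all $u,v,w\in\mathfrak{h}$ $$[u,v,w]_{\vdash}=\rho^l(Tu,Tv,w),\quad [u,v,w]_{\perp}=\rho^m(Tu,v,Tw),\quad [u,v,w]_{\dashv}=\rho^r(u,Tv,Tw).$$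
   Context: All vector spaces and (multi)linear maps are over a field $\mathbb{K}$ of characteristic zero. 3-Leibniz algebra: a vector space $\mathfrak{g}$ with a trilinear map $[\cdot,\cdot,\cdot]_{\mathfrak{g}}:\mathfrak{g}\times\mathfrak{g}\times\mathfrak{g}\to\mathfrak{g}$ such that $[a,b,[x,y,z]]=[[a,b,x],y,z]+[x,[a,b,y],z]+[x,y,[a,b,z]]$ for all $a,b,x,y,z\in\mathfrak{g}$. Representation of $(\mathfrak{g},[\cdot,\cdot,\cdot]_{\mathfrak{g}})$: a vector space $V$ with trilinear maps $\rho^l:\mathfrak{g}\otimes\mathfrak{g}\otimes V\to V$, $\rho^m:\mathfrak{g}\otimes V\otimes\mathfrak{g}\to V$, $\rho^r:V\otimes\mathfrak{g}\otimes\mathfrak{g}\to V$ such that for all $x,y,z,a,b\in\mathfrak{g}$, $u\in V$ (brackets are those of $\mathfrak{g}$): $\rho^l(a,b,\rho^l(x,y,u))=\rho^l([a,b,x],y,u)+\rho^l(x,[a,b,y],u)+\rho^l(x,y,\rho^l(a,b,u))$; $\rho^l(a,b,\rho^m(x,u,z))=\rho^m([a,b,x],u,z)+\rho^m(x,\rho^l(a,b,u),z)+\rho^m(x,u,[a,b,z])$; $\rho^l(a,b,\rho^r(u,y,z))=\rho^r(\rho^l(a,b,u),y,z)+\rho^r(u,[a,b,y],z)+\rho^r(u,y,[a,b,z])$; $\rho^m(a,u,[x,y,z])=\rho^r(\rho^m(a,u,x),y,z)+\rho^m(x,\rho^m(a,u,y),z)+\rho^l(x,y,\rho^m(a,u,z))$;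 $\rho^r(u,b,[x,y,z])=\rho^r(\rho^r(u,b,x),y,z)+\rho^m(x,\rho^r(u,b,y),z)+\rho^l(x,y,\rho^r(u,b,z))$. Embedding tensor on $\mathfrak{g}$ with respect to $V$: a linear map $T:V\to\mathfrak{g}$ with $[Tu,Tv,Tw]_{\mathfrak{g}}=T\rho^l(Tu,Tv,w)=T\rho^m(Tu,v,Tw)=T\rho^r(u,Tv,Tw)$ for all $u,v,w\in V$. 3-tri-Leibniz algebra: a vector space with three trilinear brackets $[\cdot,\cdot,\cdot]_{\dashv},[\cdot,\cdot,\cdot]_{\perp},[\cdot,\cdot,\cdot]_{\vdash}$ such that for all elements $x,y,z,a,b$ and all $\triangle\in\{\vdash,\dashv,\perp\}$: (i) $[a,b,[x,y,z]_{\triangle}]_{\dashv}=[[a,b,x]_{\dashv},y,z]_{\dashv}+[x,[a,b,y]_{\dashv},z]_{\perp}+[x,y,[a,b,z]_{\dashv}]_{\vdash}$; (ii) $[a,b,[x,y,z]_{\dashv}]_{\vdash}=[[a,b,x]_{\vdash},y,z]_{\dashv}+[x,[a,b,y]_{\triangle},z]_{\dashv}+[x,y,[a,b,z]_{\triangle}]_{\dashv}$; (iii) $[a,b,[x,y,z]_{\vdash}]_{\vdash}=[[a,b,x]_{\triangle},y,z]_{\vdash}+[x,[a,b,y]_{\triangle},z]_{\vdash}+[x,y,[a,b,z]_{\vdash}]_{\vdash}$; (iv) $[a,b,[x,y,z]_{\perp}]_{\vdash}=[[a,b,x]_{\triangle},y,z]_{\perp}+[x,[a,b,y]_{\vdash},z]_{\perp}+[x,y,[a,b,z]_{\triangle}]_{\perp}$;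 (v) $[a,b,[x,y,z]_{\triangle}]_{\perp}=[[a,b,x]_{\perp},y,z]_{\dashv}+[x,[a,b,y]_{\perp},z]_{\perp}+[x,y,[a,b,z]_{\perp}]_{\vdash}$.
   Formalization: In identities (ii)–(iv) of a 3-tri-Leibniz algebra the two occurrences of △ range independently over the three brackets; with one common △ in (iii) the claim is false (a 3-dimensional counterexample exists), and every induced algebra satisfies the independent form. *)

(* Defs.v *)
From HB Require Import structures.
From mathcomp Require Import all_boot all_order all_algebra.

Set Implicit Arguments.
Unset Strict Implicit.
Unset Printing Implicit Defensive.

Import GRing.Theory.
Local Open Scope ring_scope.

Definition trilinear (K : fieldType) (U V W X : lmodType K)
    (f : U -> V -> W -> X) : Prop :=
  [/\ forall v w, linear (fun u => f u v w),
      forall u w, linear (fun v => f u v w)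
    & forall u v, linear (fun w => f u v w)].

Record leibniz3_algebra (K : fieldType) (g : lmodType K)
    (br : g -> g -> g -> g) : Prop := Leibniz3Algebra {
  leibniz3_trilinear : trilinear br;
  leibniz3_identity : forall a b x y z : g,
    br a b (br x y z) =
      br (br a b x) y z + br x (br a b y) z + br x y (br a b z)
}.

Record leibniz3_representation (K : fieldType) (g V : lmodType K)
    (br : g -> g -> g -> g)
    (rl : g -> g -> V -> V) (rm : g -> V -> g -> V) (rr : V -> g -> g -> V) :
    Prop := Leibniz3Representation {
  rep_l_trilinear : trilinear rl;
  rep_m_trilinear : trilinear rm;
  rep_r_trilinear : trilinear rr;
  rep_ll : forall (a b x y : g) (u : V),
    rl a b (rl x y u) =
      rl (br a b x) y u + rl x (br a b y) u + rl x y (rl a b u);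
  rep_lm : forall (a b x z : g) (u : V),
    rl a b (rm x u z) =
      rm (br a b x) u z + rm x (rl a b u) z + rm x u (br a b z);
  rep_lr : forall (a b y z : g) (u : V),
    rl a b (rr u y z) =
      rr (rl a b u) y z + rr u (br a b y) z + rr u y (br a b z);
  rep_m : forall (a x y z : g) (u : V),
    rm a u (br x y z) =
      rr (rm a u x) y z + rm x (rm a u y) z + rl x y (rm a u z);
  rep_r : forall (b x y z : g) (u : V),
    rr u b (br x y z) =
      rr (rr u b x) y z + rm x (rr u b y) z + rl x y (rr u b z)
}.

Definition embedding_tensor (K : fieldType) (g V : lmodType K)
    (br : g -> g -> g -> g)
    (rl : g -> g -> V -> V) (rm : g -> V -> g -> V) (rr : V -> g -> g -> V)
    (T : {linear V -> g}) : Prop :=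
  forall u v w : V,
    [/\ br (T u) (T v) (T w) = T (rl (T u) (T v) w),
        br (T u) (T v) (T w) = T (rm (T u) v (T w))
      & br (T u) (T v) (T w) = T (rr u (T v) (T w))].

Inductive tri_op : Type := Vdash | Dashv | Perp.

(* In the identities an unspecified bracket may be any of the three, chosen
   independently at each place where it occurs: this is why [s] and [t] are
   quantified separately.  Forcing [s = t] would be too weak in
   [tri_leibniz3_vdash_vdash]: on K^3, with the Dashv and Perp brackets zero and
   br Vdash x y z = (0, x0 y0 z0, x1 y0 z0 - x0 y1 z0),
   all the identities with [s = t] hold, but
   br Vdash (br s a b x) y z depends on [s], which is impossible for brackets
   induced by an embedding tensor. *)
Record tri_leibniz3_algebra (K : fieldType) (h : lmodType K)
    (br : tri_op -> h -> h -> h -> h) : Prop := TriLeibniz3Algebra {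
  tri_leibniz3_trilinear : forall t, trilinear (br t);
  tri_leibniz3_dashv : forall (t : tri_op) (a b x y z : h),
    br Dashv a b (br t x y z) =
      br Dashv (br Dashv a b x) y z
      + br Perp x (br Dashv a b y) z
      + br Vdash x y (br Dashv a b z);
  tri_leibniz3_vdash_dashv : forall (s t : tri_op) (a b x y z : h),
    br Vdash a b (br Dashv x y z) =
      br Dashv (br Vdash a b x) y z
      + br Dashv x (br s a b y) z
      + br Dashv x y (br t a b z);
  tri_leibniz3_vdash_vdash : forall (s t : tri_op) (a b x y z : h),
    br Vdash a b (br Vdash x y z) =
      br Vdash (br s a b x) y z
      + br Vdash x (br t a b y) z
      + br Vdash x y (br Vdash a b z);
  tri_leibniz3_vdash_perp : forall (s t : tri_op) (a b x y z : h),
    br Vdash a b (br Perp x y z) =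
      br Perp (br s a b x) y z
      + br Perp x (br Vdash a b y) z
      + br Perp x y (br t a b z);
  tri_leibniz3_perp : forall (t : tri_op) (a b x y z : h),
    br Perp a b (br t x y z) =
      br Dashv (br Perp a b x) y z
      + br Perp x (br Perp a b y) z
      + br Vdash x y (br Perp a b z)
}.

(* Main.v *)
Require Import Defs.
From HB Require Import structures.
From mathcomp Require Import all_boot all_order all_algebra.
From mathcomp Require Import boolp.

Set Implicit Arguments.
Unset Strict Implicit.
Unset Printing Implicit Defensive.

Import GRing.Theory.
Local Open Scope ring_scope.

(** Call an argument slot of one of the three brackets of [h] a Lie slot when
    the map that the bracket should come from reads it through [T]: slots 1, 2
    of [Vdash] (from [rho^l (Tu, Tv, w)]), slots 1, 3 of [Perp] and slots 2, 3
    of [Dashv].  The elements of [h] that annihilate every bracket in which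
    they fill a Lie slot form a subspace, the null space, and the theorem holds
    with [g] the quotient of [h] by it and [T] the projection.

    Two facts make this work.  By construction a bracket does not change when
    the entry of a Lie slot moves inside its class, so the three brackets of
    [h] descend to maps [rho^l], [rho^m], [rho^r] of the required types.  And
    the free choice of the inner bracket in the identities for [Vdash] says
    that the difference of two brackets of the same three elements fills a Lie
    slot without effect, i.e. is null ([bracket_difference_null]).  Hence all
    three brackets induce one and the same bracket on [g]
    ([bracket_descends]): every slot is a Lie slot of some bracket, so replacing
    one bracket by another where needed makes the class of the result depend
    only on the classes of the entries.  The 3-Leibniz identity, the axioms of a
    representation and the embedding tensor condition are then the tri-Leibniz
    identities read through [T].

    The null space contains the span of the differences of brackets, which is
    the usual choice of kernel; it has the advantage of being given by
    equations, so that its elements can be recognised without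
    decomposing them into generators. *)

(** * Quotients of vector spaces *)

Section QuotientModule.
Variables (K : fieldType) (V : lmodType K) (S : {pred V}).
Hypothesis closedS : submod_closed S.

(** The alias carries the proof of closure, so that structures can be attached
    to a predicate that is a variable. *)
Definition submodule_pred of submod_closed S : {pred V} := S.

HB.instance Definition _ :=
  GRing.isZmodClosed.Build V (submodule_pred closedS) (GRing.submod_closedB closedS).

Definition quotient_module := Quotient.quot (submodule_pred closedS).
HB.instance Definition _ := GRing.Zmodule.on quotient_module.

Definition quotient_proj (u : V) : quotient_module :=
  \pi_(Quotient.quot (submodule_pred closedS))%qT u.

Definition quotient_repr (x : quotient_module) : V :=
  repr (x : Quotient.quot (submodule_pred closedS)).

Lemma quotient_reprK : cancel quotient_repr quotient_proj.
Proof. exact: reprK. Qed.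

Lemma quotient_proj_eq u v : quotient_proj u = quotient_proj v <-> u - v \in S.
Proof.
rewrite /quotient_proj -[S]/(submodule_pred closedS : {pred V}) Quotient.idealrBE.
by split=> [-> //|/eqP].
Qed.

Lemma quotient_projD : {morph quotient_proj : u v / u + v}.
Proof. exact: (raddfD (\pi_(Quotient.quot (submodule_pred closedS)))%qT). Qed.

Definition quotient_scale (a : K) (x : quotient_module) :=
  quotient_proj (a *: quotient_repr x).

Lemma quotient_projZ a u : quotient_proj (a *: u) = quotient_scale a (quotient_proj u).
Proof.
apply/quotient_proj_eq; rewrite -scalerBr -[_ *: _]addr0.
by apply: closedS.2 closedS.1; apply/quotient_proj_eq; rewrite quotient_reprK.
Qed.

Lemma quotient_scaleA a b x :
  quotient_scale a (quotient_scale b x) = quotient_scale (a * b) x.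
Proof. by rewrite -[x]quotient_reprK -!quotient_projZ scalerA. Qed.

Lemma quotient_scale1 : left_id 1 quotient_scale.
Proof. by move=> x; rewrite -[x]quotient_reprK -quotient_projZ scale1r. Qed.

Lemma quotient_scaleDr : right_distributive quotient_scale +%R.
Proof.
move=> a x y; rewrite -[x]quotient_reprK -[y]quotient_reprK.
by rewrite -quotient_projD -!quotient_projZ -quotient_projD scalerDr.
Qed.

Lemma quotient_scaleDl x : {morph quotient_scale^~ x : a b / a + b}.
Proof.
move=> a b; rewrite -[x]quotient_reprK.
by rewrite -!quotient_projZ -quotient_projD scalerDl.
Qed.

HB.instance Definition _ := GRing.Zmodule_isLmodule.Build K quotient_module
  quotient_scaleA quotient_scale1 quotient_scaleDr quotient_scaleDl.

Lemma quotient_proj_linear : linear quotient_proj.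
Proof. by move=> a u v; rewrite quotient_projD quotient_projZ. Qed.

HB.instance Definition _ := GRing.isLinear.Build K V quotient_module _
  quotient_proj quotient_proj_linear.

End QuotientModule.

(** Packages the quotient as a projection [T] with a (non-linear) section [s].
    Subspaces need not be decidable here, so the quotient type, whose relation
    is boolean, is formed by excluded middle. *)
Lemma exists_quotient (K : fieldType) (V : lmodType K) (P : V -> Prop) :
    P 0 -> (forall a u v, P u -> P v -> P (a *: u + v)) ->
  exists (g : lmodType K) (T : {linear V -> g}) (s : g -> V),
    cancel s T /\ forall u v, T u = T v <-> P (u - v).
Proof.
move=> P0 PD; pose S : {pred V} := fun u => `[< P u >].
have closedS : submod_closed S.
  split; first exact/asboolP.
  by move=> a u v /asboolP Pu /asboolP Pv; apply/asboolP/PD.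
exists (quotient_module closedS), (@quotient_proj K V S closedS).
exists (@quotient_repr K V S closedS).
split=> [|u v]; first exact: quotient_reprK.
by rewrite quotient_proj_eq; split=> /asboolP.
Qed.

(** * Null elements of a 3-tri-Leibniz algebra *)

Lemma linear_propB (K : fieldType) (U V : lmodType K) (f : U -> V) :
  linear f -> forall u v, f (u - v) = f u - f v.
Proof. by move=> fL u v; rewrite addrC -scaleN1r fL scaleN1r addrC. Qed.

Lemma linear_prop0 (K : fieldType) (U V : lmodType K) (f : U -> V) :
  linear f -> f 0 = 0.
Proof. by move=> fL; rewrite -(subrr 0) linear_propB ?subrr. Qed.

Section NullElements.
Variables (K : fieldType) (h : lmodType K) (br : tri_op -> h -> h -> h -> h).
Hypothesis hbr : tri_leibniz3_algebra br.

Let br_linear1 t v w : linear (fun u => br t u v w).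
Proof. by case: (tri_leibniz3_trilinear hbr t). Qed.

Let br_linear2 t u w : linear (fun v => br t u v w).
Proof. by case: (tri_leibniz3_trilinear hbr t). Qed.

Let br_linear3 t u v : linear (fun w => br t u v w).
Proof. by case: (tri_leibniz3_trilinear hbr t). Qed.

(** The six equations are indexed by the Lie slots; they are what makes the
    representation maps well defined on classes. *)
Record null (i : h) : Prop := Null {
  null_vdash1 : forall v w, br Vdash i v w = 0;
  null_vdash2 : forall u w, br Vdash u i w = 0;
  null_perp1 : forall v w, br Perp i v w = 0;
  null_perp3 : forall u v, br Perp u v i = 0;
  null_dashv2 : forall u w, br Dashv u i w = 0;
  null_dashv3 : forall u v, br Dashv u v i = 0
}.

Lemma null0 : null 0.
Proof.
split=> u v; [exact: (linear_prop0 (br_linear1 _ _ _))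
  | exact: (linear_prop0 (br_linear2 _ _ _))
  | exact: (linear_prop0 (br_linear1 _ _ _))
  | exact: (linear_prop0 (br_linear3 _ _ _))
  | exact: (linear_prop0 (br_linear2 _ _ _))
  | exact: (linear_prop0 (br_linear3 _ _ _))].
Qed.

Lemma null_linear a i j : null i -> null j -> null (a *: i + j).
Proof.
move=> [i1 i2 i3 i4 i5 i6] [j1 j2 j3 j4 j5 j6]; split=> u v;
  rewrite ?br_linear1 ?br_linear2 ?br_linear3;
  by rewrite ?(i1, i2, i3, i4, i5, i6) ?(j1, j2, j3, j4, j5, j6) scaler0 addr0.
Qed.

(** Each equation compares two instances of one identity that differ only in
    the bracket chosen for the inner term in the Lie slot concerned. *)
Lemma bracket_difference_null s t a b c : null (br s a b c - br t a b c).
Proof.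
split=> u v; [rewrite (linear_propB (br_linear1 _ _ _))
  | rewrite (linear_propB (br_linear2 _ _ _))
  | rewrite (linear_propB (br_linear1 _ _ _))
  | rewrite (linear_propB (br_linear3 _ _ _))
  | rewrite (linear_propB (br_linear2 _ _ _))
  | rewrite (linear_propB (br_linear3 _ _ _))]; apply/eqP; rewrite subr_eq0; apply/eqP.
- have := tri_leibniz3_vdash_vdash hbr s t a b c u v.
  by rewrite (tri_leibniz3_vdash_vdash hbr t t) => /addIr/addIr.
- have := tri_leibniz3_vdash_vdash hbr t s a b u c v.
  by rewrite (tri_leibniz3_vdash_vdash hbr t t) => /addIr/addrI.
- have := tri_leibniz3_vdash_perp hbr s t a b c u v.
  by rewrite (tri_leibniz3_vdash_perp hbr t t) => /addIr/addIr.
- have := tri_leibniz3_vdash_perp hbr t s a b u v c.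
  by rewrite (tri_leibniz3_vdash_perp hbr t t) => /addrI.
- have := tri_leibniz3_vdash_dashv hbr s t a b u c v.
  by rewrite (tri_leibniz3_vdash_dashv hbr t t) => /addIr/addrI.
- have := tri_leibniz3_vdash_dashv hbr t s a b u v c.
  by rewrite (tri_leibniz3_vdash_dashv hbr t t) => /addrI.
Qed.

(** * The embedding tensor onto the quotient by the null space *)

Variables (g : lmodType K) (T : {linear h -> g}) (s : g -> h).
Hypothesis sK : cancel s T.
Hypothesis T_eq : forall u v, T u = T v <-> null (u - v).

Definition quotient_rl (x y : g) (w : h) : h := br Vdash (s x) (s y) w.
Definition quotient_rm (x : g) (v : h) (z : g) : h := br Perp (s x) v (s z).
Definition quotient_rr (u : h) (y z : g) : h := br Dashv u (s y) (s z).
Definition quotient_bracket (x y z : g) : g := T (br Vdash (s x) (s y) (s z)).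

Let null_sT u : null (s (T u) - u).
Proof. by apply/T_eq; rewrite sK. Qed.

Lemma quotient_rlE u v w : quotient_rl (T u) (T v) w = br Vdash u v w.
Proof.
rewrite /quotient_rl; transitivity (br Vdash u (s (T v)) w); apply/subr0_eq.
  by rewrite -(linear_propB (br_linear1 _ _ _)) (null_vdash1 (null_sT u)).
by rewrite -(linear_propB (br_linear2 _ _ _)) (null_vdash2 (null_sT v)).
Qed.

Lemma quotient_rmE u v w : quotient_rm (T u) v (T w) = br Perp u v w.
Proof.
rewrite /quotient_rm; transitivity (br Perp u v (s (T w))); apply/subr0_eq.
  by rewrite -(linear_propB (br_linear1 _ _ _)) (null_perp1 (null_sT u)).
by rewrite -(linear_propB (br_linear3 _ _ _)) (null_perp3 (null_sT w)).
Qed.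

Lemma quotient_rrE u v w : quotient_rr u (T v) (T w) = br Dashv u v w.
Proof.
rewrite /quotient_rr; transitivity (br Dashv u v (s (T w))); apply/subr0_eq.
  by rewrite -(linear_propB (br_linear2 _ _ _)) (null_dashv2 (null_sT v)).
by rewrite -(linear_propB (br_linear3 _ _ _)) (null_dashv3 (null_sT w)).
Qed.

(** The first two entries are changed inside [Vdash], the last one inside
    [Dashv]; passing from one bracket to another is invisible to [T]. *)
Lemma bracket_descends t u v w :
  quotient_bracket (T u) (T v) (T w) = T (br t u v w).
Proof.
have T_br r1 r2 a b c : T (br r1 a b c) = T (br r2 a b c).
  exact/T_eq/bracket_difference_null.
rewrite /quotient_bracket -/(quotient_rl (T u) (T v) _) quotient_rlE.
rewrite (T_br Vdash Dashv) (T_br t Dashv); congr (T _); apply/subr0_eq.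
by rewrite -(linear_propB (br_linear3 _ _ _)) (null_dashv3 (null_sT w)).
Qed.

Lemma quotient_rl_trilinear : trilinear quotient_rl.
Proof.
split=> [y w a x x' | x w a y y' | x y a w w' ]; last exact: br_linear3.
  rewrite -[x]sK -[x']sK -[y]sK -linearP !quotient_rlE; exact: br_linear1.
rewrite -[x]sK -[y']sK -[y]sK -linearP !quotient_rlE; exact: br_linear2.
Qed.

Lemma quotient_rm_trilinear : trilinear quotient_rm.
Proof.
split=> [v z a x x' | x z a v v' | x v a z z' ]; last first.
- rewrite -[x]sK -[z]sK -[z']sK -linearP !quotient_rmE; exact: br_linear3.
- exact: br_linear2.
rewrite -[x]sK -[x']sK -[z]sK -linearP !quotient_rmE; exact: br_linear1.
Qed.

Lemma quotient_rr_trilinear : trilinear quotient_rr.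
Proof.
split=> [y z a u u' | u z a y y' | u y a z z' ]; first exact: br_linear1.
  rewrite -[y]sK -[y']sK -[z]sK -linearP !quotient_rrE; exact: br_linear2.
rewrite -[y]sK -[z]sK -[z']sK -linearP !quotient_rrE; exact: br_linear3.
Qed.

Lemma quotient_bracket_trilinear : trilinear quotient_bracket.
Proof.
split=> [y z a x x' | x z a y y' | x y a z z' ].
- rewrite -[x]sK -[x']sK -[y]sK -[z]sK -linearP !(bracket_descends Vdash).
  by rewrite br_linear1 linearP.
- rewrite -[x]sK -[y']sK -[y]sK -[z]sK -linearP !(bracket_descends Vdash).
  by rewrite br_linear2 linearP.
- rewrite -[x]sK -[y]sK -[z]sK -[z']sK -linearP !(bracket_descends Vdash).
  by rewrite br_linear3 linearP.
Qed.

Lemma quotient_leibniz3 : leibniz3_algebra quotient_bracket.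
Proof.
split=> [|a b x y z]; first exact: quotient_bracket_trilinear.
rewrite -[a]sK -[b]sK -[x]sK -[y]sK -[z]sK !(bracket_descends Vdash).
by rewrite (tri_leibniz3_vdash_vdash hbr Vdash Vdash) !raddfD.
Qed.

Lemma quotient_representation :
  leibniz3_representation quotient_bracket quotient_rl quotient_rm quotient_rr.
Proof.
split.
- exact: quotient_rl_trilinear.
- exact: quotient_rm_trilinear.
- exact: quotient_rr_trilinear.
- move=> a b x y u; rewrite -[a]sK -[b]sK -[x]sK -[y]sK.
  rewrite !(bracket_descends Vdash) !quotient_rlE.
  exact: tri_leibniz3_vdash_vdash.
- move=> a b x z u; rewrite -[a]sK -[b]sK -[x]sK -[z]sK.
  rewrite !(bracket_descends Vdash) !quotient_rmE !quotient_rlE.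
  exact: tri_leibniz3_vdash_perp.
- move=> a b y z u; rewrite -[a]sK -[b]sK -[y]sK -[z]sK.
  rewrite !(bracket_descends Vdash) !quotient_rrE !quotient_rlE.
  exact: tri_leibniz3_vdash_dashv.
- move=> a x y z u; rewrite -[a]sK -[x]sK -[y]sK -[z]sK.
  rewrite !(bracket_descends Vdash) !quotient_rmE !quotient_rrE !quotient_rlE.
  exact: tri_leibniz3_perp.
- move=> b x y z u; rewrite -[b]sK -[x]sK -[y]sK -[z]sK.
  rewrite !(bracket_descends Vdash) !quotient_rrE !quotient_rmE !quotient_rlE.
  exact: tri_leibniz3_dashv.
Qed.

Lemma quotient_embedding_tensor :
  embedding_tensor quotient_bracket quotient_rl quotient_rm quotient_rr T.
Proof.
by move=> u v w; rewrite quotient_rlE quotient_rmE quotient_rrE;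
  split; exact: bracket_descends.
Qed.

End NullElements.

Theorem theorem3p12 (K : fieldType) (charK0 : [pchar K] =i pred0)
    (h : lmodType K) (br : tri_op -> h -> h -> h -> h)
    (hbr : tri_leibniz3_algebra br) :
  exists (g : lmodType K) (brg : g -> g -> g -> g)
         (rl : g -> g -> h -> h) (rm : g -> h -> g -> h) (rr : h -> g -> g -> h)
         (T : {linear h -> g}),
    [/\ leibniz3_algebra brg,
        leibniz3_representation brg rl rm rr,
        embedding_tensor brg rl rm rr T
      & forall u v w : h,
          [/\ br Vdash u v w = rl (T u) (T v) w,
              br Perp u v w = rm (T u) v (T w)
            & br Dashv u v w = rr u (T v) (T w)]].
Proof.
have [g [T [s [sK T_eq]]]] := exists_quotient (null0 hbr) (@null_linear _ _ _ hbr).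
exists g, (quotient_bracket br T s), (quotient_rl br s), (quotient_rm br s).
exists (quotient_rr br s), T; split.
- exact: quotient_leibniz3.
- exact: quotient_representation.
- exact: quotient_embedding_tensor.
- by move=> u v w; rewrite (quotient_rlE hbr sK T_eq) (quotient_rmE hbr sK T_eq)
    (quotient_rrE hbr sK T_eq).
Qed.
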